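(* Let $G$ be a group. The cubical sets $\mathrm L(\mathrm N^\square G)$ and $\mathrm N^{\mathrm R}G$ are isomorphic.
   Context: **Cubical sets.** $\square$ is the category with objects $\square_n=\{0,1\}^n$ and morphisms generated by $\delta_{i,\epsilon}:\square_{n-1}\to\square_n$ (insert $\epsilon\in\{0,1\}$ in position $i$) and $\sigma_i:\square_n\to\square_{n-1}$ (delete the $i$-th coordinate), $1\le i\le n$. A cubical set is a functor $X:\square^{op}\to\mathbf{Set}$; $X_n=X(\square_n)$, $d_{i,\epsilon}=X(\delta_{i,\epsilon})$, $s_i=X(\sigma_i)$. Morphisms are natural transformations. **Cubical nerve.** $G$ is viewed as a one-object category in which the composite ''first $g$, then $h$'' is the product $gh$, and $\square_n$ as a poset (product order). $\mathrm N^\square G=\mathrm{Hom}_{\mathbf{Cat}}(-,G):\square^{op}\to\mathbf{Set}$, so $(\mathrm N^\square G)_n$ is the set of functors $\square_n\to G$, with structure maps given by precomposition. **The construction $\mathrm L$.** For a cubical set $X$, $\mathrm LX_0=\{\star\}$ and, for $n\ge1$, $\mathrm LX_n\subseteq X_n$ is the set of $x$ such that for every $1\le k\le n$ the element $d_{1,\epsilon_1}\cdots d_{1,\epsilon_k}x$ does not depend on $(\epsilon_1,\dots,\epsilon_k)\in\{0,1\}^k$; faces and degeneracies are the restrictions of those of $X$. (Here $(\mathrm N^\square G)_0$ is a single point.) **The cubical set $\mathrm N^{\mathrm R}G$.** $(\mathrm N^{\mathrm R}G)_n=G^n$ with $d_{i,0}(g_1,\dots,g_n)=(g_1,\dots,g_{i-1},g_{i+1},\dots,g_n)$,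 $d_{i,1}(g_1,\dots,g_n)=(g_i^{-1}g_1g_i,\dots,g_i^{-1}g_{i-1}g_i,g_{i+1},\dots,g_n)$, $s_i(g_1,\dots,g_n)=(g_1,\dots,g_{i-1},e,g_i,\dots,g_n)$. *)

(* Defs.v *)
From HB Require Import structures.
From mathcomp Require Import all_boot.
From mathcomp Require Import boolp zify.

Set Implicit Arguments.
Unset Strict Implicit.
Unset Printing Implicit Defensive.

Local Open Scope group_scope.

(* Composition is written in diagrammatic order: [cmp f g] is "first f, then
   g". *)
Record category := Category {
  ob :> Type;
  hom : ob -> ob -> Type;
  idm : forall x, hom x x;
  cmp : forall x y z, hom x y -> hom y z -> hom x z;
  cmp_idl : forall x y (f : hom x y), cmp (idm x) f = f;
  cmp_idr : forall x y (f : hom x y), cmp f (idm y) = f;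
  cmpA : forall x y z t (f : hom x y) (g : hom y z) (h : hom z t),
    cmp f (cmp g h) = cmp (cmp f g) h }.

Arguments hom {c} x y.
Arguments idm {c} x.
Arguments cmp {c x y z} f g.

Record functor (C D : category) := Functor {
  fob :> C -> D;
  fmap : forall x y, hom x y -> hom (fob x) (fob y);
  fmap_id : forall x, fmap (idm x) = idm (fob x);
  fmap_cmp : forall x y z (f : hom x y) (g : hom y z),
    fmap (cmp f g) = cmp (fmap f) (fmap g) }.

Arguments fmap {C D} F {x y} f : rename.

Lemma functor_comp_id (B C D : category) (F : functor B C) (H : functor C D)
    (x : B) : fmap H (fmap F (idm x)) = idm (H (F x)).
Proof. by rewrite !fmap_id. Qed.

Lemma functor_comp_cmp (B C D : category) (F : functor B C) (H : functor C D)
    (x y z : B) (f : hom x y) (g : hom y z) :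
  fmap H (fmap F (cmp f g)) = cmp (fmap H (fmap F f)) (fmap H (fmap F g)).
Proof. by rewrite !fmap_cmp. Qed.

Definition functor_comp (B C D : category) (F : functor B C) (H : functor C D) :
    functor B D :=
  {| fob := fun x => H (F x);
     fmap := fun x y f => fmap H (fmap F f);
     fmap_id := functor_comp_id F H;
     fmap_cmp := functor_comp_cmp F H |}.

(* Contravariant functors to sets. *)
Record presheaf (C : category) := Presheaf {
  psh_ob :> C -> Type;
  psh_map : forall x y, hom x y -> psh_ob y -> psh_ob x;
  psh_id : forall x (a : psh_ob x), psh_map (idm x) a = a;
  psh_cmp : forall x y z (f : hom x y) (g : hom y z) (a : psh_ob z),
    psh_map (cmp f g) a = psh_map f (psh_map g a) }.

Arguments psh_map {C} X {x y} f a : rename.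

Record psh_hom (C : category) (X Y : presheaf C) := PshHom {
  nt :> forall x : C, X x -> Y x;
  nt_natural : forall (x y : C) (f : hom x y) (a : X y),
    nt (psh_map X f a) = psh_map Y f (nt a) }.

Definition psh_idm (C : category) (X : presheaf C) : psh_hom X X :=
  {| nt := fun x a => a; nt_natural := fun x y f a => erefl |}.

Lemma psh_comp_natural (C : category) (X Y Z : presheaf C) (u : psh_hom X Y)
    (v : psh_hom Y Z) (x y : C) (f : hom x y) (a : X y) :
  v x (u x (psh_map X f a)) = psh_map Z f (v y (u y a)).
Proof. by rewrite !nt_natural. Qed.

Definition psh_comp (C : category) (X Y Z : presheaf C) (u : psh_hom X Y)
    (v : psh_hom Y Z) : psh_hom X Z :=
  {| nt := fun x a => v x (u x a); nt_natural := psh_comp_natural u v |}.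

Definition isomorphic (C : category) (X Y : presheaf C) : Prop :=
  exists (u : psh_hom X Y) (v : psh_hom Y X),
    psh_comp u v = psh_idm X /\ psh_comp v u = psh_idm Y.

(* Coordinates are numbered from 0, so index i of the usual convention
   1 <= i <= n is the ordinal i - 1 of 'I_n. *)
Definition cube (n : nat) := {ffun 'I_n -> bool}.

Definition cube_insert n (i : 'I_n.+1) (e : bool) (x : cube n) : cube n.+1 :=
  [ffun j => if unlift i j is Some k then x k else e].

Definition cube_delete n (i : 'I_n.+1) (x : cube n.+1) : cube n :=
  [ffun j => x (lift i j)].

(* Formal composites of the generators of the box category. *)
Inductive box_word : nat -> nat -> Type :=
| WId n : box_word n n
| WComp m n p : box_word m n -> box_word n p -> box_word m p
| WDelta n (i : 'I_n.+1) (e : bool) : box_word n n.+1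
| WSigma n (i : 'I_n.+1) : box_word n.+1 n.

Fixpoint word_fun m n (w : box_word m n) : cube m -> cube n :=
  match w in box_word m n return cube m -> cube n with
  | WId _ => fun x => x
  | WComp _ _ _ u v => fun x => word_fun v (word_fun u x)
  | WDelta _ i e => cube_insert i e
  | WSigma _ i => cube_delete i
  end.

Definition box_hom (m n : nat) : Type :=
  {f : cube m -> cube n | exists w : box_word m n, f = word_fun w}.

Lemma box_hom_eq m n (f g : box_hom m n) : sval f =1 sval g -> f = g.
Proof.
case: f g => [f Pf] [g Pg] /= /funext fg.
by subst g; rewrite (Prop_irrelevance Pf Pg).
Qed.

Definition box_of_word m n (w : box_word m n) : box_hom m n :=
  exist _ (word_fun w) (ex_intro _ w erefl).

Definition box_id (n : nat) : box_hom n n := box_of_word (WId n).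

Lemma box_comp_subproof m n p (f : box_hom m n) (g : box_hom n p) :
  exists w : box_word m p, sval g \o sval f = word_fun w.
Proof.
have [u fu] := svalP f; have [v gv] := svalP g.
by exists (WComp u v); rewrite fu gv.
Qed.

Definition box_comp m n p (f : box_hom m n) (g : box_hom n p) : box_hom m p :=
  exist _ (sval g \o sval f) (box_comp_subproof f g).

Lemma box_idl m n (f : box_hom m n) : box_comp (box_id m) f = f.
Proof. exact: box_hom_eq. Qed.

Lemma box_idr m n (f : box_hom m n) : box_comp f (box_id n) = f.
Proof. exact: box_hom_eq. Qed.

Lemma box_compA m n p q (f : box_hom m n) (g : box_hom n p) (h : box_hom p q) :
  box_comp f (box_comp g h) = box_comp (box_comp f g) h.
Proof. exact: box_hom_eq. Qed.

(* The object n stands for the n-cube {0,1}^n. *)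
Definition box : category :=
  {| ob := nat; hom := box_hom; idm := box_id; cmp := box_comp;
     cmp_idl := box_idl; cmp_idr := box_idr; cmpA := box_compA |}.

Definition delta n (i : 'I_n.+1) (e : bool) : box_hom n n.+1 :=
  box_of_word (WDelta i e).

Definition sigma n (i : 'I_n.+1) : box_hom n.+1 n :=
  box_of_word (WSigma i).

Definition cubical_set := presheaf box.

Definition face (X : cubical_set) n (i : 'I_n.+1) (e : bool) :
    X n.+1 -> X n :=
  @psh_map box X n n.+1 (delta i e).

Definition degeneracy (X : cubical_set) n (i : 'I_n.+1) : X n -> X n.+1 :=
  @psh_map box X n.+1 n (sigma i).

Lemma box_hom_ind (P : forall m n, box_hom m n -> Prop) :
  (forall n, P n n (box_id n)) ->
  (forall m n p (f : box_hom m n) (g : box_hom n p),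
     P m n f -> P n p g -> P m p (box_comp f g)) ->
  (forall n (i : 'I_n.+1) e, P n n.+1 (delta i e)) ->
  (forall n (i : 'I_n.+1), P n.+1 n (sigma i)) ->
  forall m n (f : box_hom m n), P m n f.
Proof.
move=> Pid Pcomp Pd Ps m n [f [w fw]].
have -> : exist _ f (ex_intro _ w fw) = box_of_word w.
  by apply: box_hom_eq => x /=; rewrite fw.
elim: w {f fw} => //= {}m {}n p u IHu v IHv.
have -> : box_of_word (WComp u v) = box_comp (box_of_word u) (box_of_word v).
  exact: box_hom_eq.
exact: Pcomp.
Qed.

(* A cubical set given by its faces and degeneracies.  A morphism of the box
   category acts by the composite of the operators along a word representing
   it, and [coh] says that the choice of the word is irrelevant. *)
Fixpoint word_act (X : nat -> Type)
    (d : forall n, 'I_n.+1 -> bool -> X n.+1 -> X n)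
    (s : forall n, 'I_n.+1 -> X n -> X n.+1)
    m n (w : box_word m n) : X n -> X m :=
  match w in box_word m n return X n -> X m with
  | WId _ => fun a => a
  | WComp _ _ _ u v => fun a => word_act d s u (word_act d s v a)
  | WDelta _ i e => d _ i e
  | WSigma _ i => s _ i
  end.

Definition word_coherent (X : nat -> Type)
    (d : forall n, 'I_n.+1 -> bool -> X n.+1 -> X n)
    (s : forall n, 'I_n.+1 -> X n -> X n.+1) : Prop :=
  forall m n (w w' : box_word m n),
    word_fun w = word_fun w' -> word_act d s w = word_act d s w'.

Definition box_act (X : nat -> Type)
    (d : forall n, 'I_n.+1 -> bool -> X n.+1 -> X n)
    (s : forall n, 'I_n.+1 -> X n -> X n.+1)
    m n (f : box_hom m n) : X n -> X m :=
  word_act d s (sval (cid (svalP f))).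

Lemma box_act_word (X : nat -> Type)
    (d : forall n, 'I_n.+1 -> bool -> X n.+1 -> X n)
    (s : forall n, 'I_n.+1 -> X n -> X n.+1) (coh : word_coherent d s)
    m n (f : box_hom m n) (w : box_word m n) :
  sval f = word_fun w -> box_act d s f = word_act d s w.
Proof.
by rewrite /box_act => fw; case: cid => w' /= fw'; apply: coh; rewrite -fw -fw'.
Qed.

Lemma box_act_id (X : nat -> Type)
    (d : forall n, 'I_n.+1 -> bool -> X n.+1 -> X n)
    (s : forall n, 'I_n.+1 -> X n -> X n.+1) (coh : word_coherent d s)
    n (a : X n) : box_act d s (box_id n) a = a.
Proof. by rewrite (box_act_word coh (w := WId n)). Qed.

Lemma box_act_comp (X : nat -> Type)
    (d : forall n, 'I_n.+1 -> bool -> X n.+1 -> X n)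
    (s : forall n, 'I_n.+1 -> X n -> X n.+1) (coh : word_coherent d s)
    m n p (f : box_hom m n) (g : box_hom n p) (a : X p) :
  box_act d s (box_comp f g) a = box_act d s f (box_act d s g a).
Proof.
case: f g => [f [u fu]] [g [v gv]].
rewrite (box_act_word coh (w := WComp u v)) /=; last by rewrite fu gv.
by rewrite (box_act_word coh (w := u)) // (box_act_word coh (w := v)).
Qed.

Definition cubical_of_generators (X : nat -> Type)
    (d : forall n, 'I_n.+1 -> bool -> X n.+1 -> X n)
    (s : forall n, 'I_n.+1 -> X n -> X n.+1) (coh : word_coherent d s) :
    cubical_set :=
  @Presheaf box X (box_act d s) (box_act_id coh) (box_act_comp coh).

Lemma cubical_of_generators_face (X : nat -> Type)
    (d : forall n, 'I_n.+1 -> bool -> X n.+1 -> X n)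
    (s : forall n, 'I_n.+1 -> X n -> X n.+1) (coh : word_coherent d s)
    n (i : 'I_n.+1) (e : bool) (a : X n.+1) :
  face (X := cubical_of_generators coh) i e a = d n i e a.
Proof.
by rewrite /face /cubical_of_generators /= (box_act_word coh (w := WDelta i e)).
Qed.

Lemma cubical_of_generators_degeneracy (X : nat -> Type)
    (d : forall n, 'I_n.+1 -> bool -> X n.+1 -> X n)
    (s : forall n, 'I_n.+1 -> X n -> X n.+1) (coh : word_coherent d s)
    n (i : 'I_n.+1) (a : X n) :
  degeneracy (X := cubical_of_generators coh) i a = s n i a.
Proof.
by rewrite /degeneracy /cubical_of_generators /=
     (box_act_word coh (w := WSigma i)).
Qed.

(* The poset {0,1}^n with the product order. *)
Definition cube_le n (x y : cube n) : bool := [forall i, x i <= y i].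

Lemma cube_le_refl n (x : cube n) : cube_le x x.
Proof. exact/forallP. Qed.

Lemma cube_le_trans n (x y z : cube n) :
  cube_le x y -> cube_le y z -> cube_le x z.
Proof.
move=> /forallP xy /forallP yz; apply/forallP => i.
exact: leq_trans (xy i) (yz i).
Qed.

Definition cube_cat (n : nat) : category :=
  {| ob := cube n; hom := @cube_le n;
     idm := @cube_le_refl n; cmp := @cube_le_trans n;
     cmp_idl := fun x y f => bool_irrelevance _ f;
     cmp_idr := fun x y f => bool_irrelevance _ f;
     cmpA := fun x y z t f g h => bool_irrelevance _ _ |}.

Definition group_cat (G : groupType) : category :=
  {| ob := unit; hom := fun _ _ => G;
     idm := fun _ => 1; cmp := fun _ _ _ g h => g * h;
     cmp_idl := fun _ _ => @mul1g G;
     cmp_idr := fun _ _ => @mulg1 G;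
     cmpA := fun _ _ _ _ => @mulgA G |}.

Lemma box_hom_mono m n (f : box_hom m n) (x y : cube m) :
  cube_le x y -> cube_le (sval f x) (sval f y).
Proof.
elim/box_hom_ind: m n / f x y => [//|m n p f g IHf IHg|n i e|n i] x y xy.
- by apply: IHg; apply: IHf.
- apply/forallP => j; rewrite !ffunE; case: unliftP => // k _.
  exact: (forallP xy).
- by apply/forallP => j; rewrite !ffunE; apply: (forallP xy).
Qed.

Definition box_functor m n (f : box_hom m n) :
    functor (cube_cat m) (cube_cat n) :=
  {| fob := sval f : cube_cat m -> cube_cat n;
     fmap := fun x y xy => @box_hom_mono m n f x y xy;
     fmap_id := fun x => bool_irrelevance _ _;
     fmap_cmp := fun x y z xy yz => bool_irrelevance _ _ |}.

Lemma functor_group_eq (C : category) (G : groupType)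
    (F H : functor C (group_cat G)) :
  (forall (x y : C) (f : hom x y), fmap F f = fmap H f :> G) -> F = H.
Proof.
case: F H => [F Ff Fi Fc] [H Hf Hi Hc] /= FH.
have eFH : F = H by apply: funext => x; case: (F x); case: (H x).
subst H.
have eFf : Ff = Hf.
  by apply: functional_extensionality_dep => x;
     apply: functional_extensionality_dep => y; apply: funext => f; apply: FH.
subst Hf.
by rewrite (Prop_irrelevance Fi Hi) (Prop_irrelevance Fc Hc).
Qed.

Definition nerve_map (G : groupType) m n (f : box_hom m n)
    (F : functor (cube_cat n) (group_cat G)) :
    functor (cube_cat m) (group_cat G) :=
  functor_comp (box_functor f) F.

Lemma nerve_map_id (G : groupType) n
    (F : functor (cube_cat n) (group_cat G)) : nerve_map (box_id n) F = F.
Proof.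
apply: functor_group_eq => x y f /=.
by congr (fmap F _ : G); apply: bool_irrelevance.
Qed.

Lemma nerve_map_comp (G : groupType) m n p (f : box_hom m n) (g : box_hom n p)
    (F : functor (cube_cat p) (group_cat G)) :
  nerve_map (box_comp f g) F = nerve_map f (nerve_map g F).
Proof.
apply: functor_group_eq => x y xy /=.
by congr (fmap F _ : G); apply: bool_irrelevance.
Qed.

Definition nerve (G : groupType) : cubical_set :=
  @Presheaf box (fun n => functor (cube_cat n) (group_cat G))
    (@nerve_map G) (@nerve_map_id G) (@nerve_map_comp G).

(* [iter_face1 eps x] is d_{1,eps_1} ... d_{1,eps_k} x; the innermost operator,
   applied first, is d_{1,eps_k}. *)
Fixpoint iter_face1 (X : cubical_set) (k m : nat) :
    cube k -> X (k + m)%N -> X m :=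
  match k return cube k -> X (k + m)%N -> X m with
  | 0 => fun _ x => x
  | k'.+1 => fun eps x =>
      iter_face1 [ffun j => eps (lift ord_max j)]
        (face (n := k' + m) ord0 (eps ord_max) x)
  end.

(* The equation n = k + m with 0 < k expresses 1 <= k <= n, with m = n - k. *)
Definition L_cond (X : cubical_set) (n : nat) (x : X n) : Prop :=
  forall (k m : nat) (nkm : n = (k + m)%N), 0 < k ->
  forall eps eps' : cube k,
    iter_face1 eps (ecast p (X p) nkm x) =
    iter_face1 eps' (ecast p (X p) nkm x).

(* X_0 is a single point.  This is what makes the degeneracies defined on
   LX_0 = {*} restrictions of those of X. *)
Definition reduced (X : cubical_set) : Type := {v : X 0 | forall x, x = v}.

Definition L_ob (X : cubical_set) (n : nat) : Type :=
  match n with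
  | 0 => unit
  | n'.+1 => {x : X n'.+1 | L_cond x}
  end.

Definition L_incl (X : cubical_set) (hX : reduced X) n : L_ob X n -> X n :=
  match n return L_ob X n -> X n with
  | 0 => fun _ => sval hX
  | n'.+1 => fun y => sval y
  end.

Definition L_mk (X : cubical_set) n : forall x : X n, L_cond x -> L_ob X n :=
  match n return forall x : X n, L_cond x -> L_ob X n with
  | 0 => fun _ _ => tt
  | n'.+1 => fun x hx => exist _ x hx
  end.

Lemma L_inclK (X : cubical_set) (hX : reduced X) n (x : X n) (hx : L_cond x) :
  L_incl hX (L_mk hx) = x.
Proof. by case: n x hx => [|n] x hx //=; rewrite (svalP hX x). Qed.

Lemma L_incl_inj (X : cubical_set) (hX : reduced X) n :
  injective (@L_incl X hX n).
Proof.
case: n => [[] []//|n] [x hx] [y hy] /= xy; subst y.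
by rewrite (Prop_irrelevance hx hy).
Qed.

Lemma L_incl_cond (X : cubical_set) (hX : reduced X) n (y : L_ob X n) :
  L_cond (L_incl hX y).
Proof.
case: n y => [y|n [x hx] //] k m e k0 eps eps'; exfalso.
by move: e k0; clear; lia.
Qed.

(* Reading a vertex of a cube as a function on nat, false outside the cube. *)
Definition cube_ext n (x : cube n) (j : nat) : bool := oapp x false (insub j).

Lemma cube_extE n (x : cube n) (j : 'I_n) : cube_ext x j = x j.
Proof. by rewrite /cube_ext valK. Qed.

Lemma cube_ext_lt n (x : cube n) j (jn : j < n) :
  cube_ext x j = x (Ordinal jn).
Proof. exact: (cube_extE x (Ordinal jn)). Qed.

Lemma cube_ext_out n (x : cube n) j : n <= j -> cube_ext x j = false.
Proof. by move=> nj; rewrite /cube_ext insubF // ltnNge nj. Qed.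

Lemma cube_ext_inj n (x y : cube n) : cube_ext x =1 cube_ext y -> x = y.
Proof. by move=> xy; apply/ffunP => j; rewrite -!cube_extE. Qed.

Lemma cube_ext_insert n (i : 'I_n.+1) e (x : cube n) j :
  cube_ext (cube_insert i e x) j =
  if j < i then cube_ext x j else if j == i then e else cube_ext x j.-1.
Proof.
have [jn|jn] := ltnP j n.+1; last first.
  have ij := leq_trans (ltn_ord i) jn.
  rewrite cube_ext_out // ifN; last by lia.
  by rewrite ifN ?cube_ext_out //; lia.
rewrite (cube_ext_lt _ jn) ffunE; case: unliftP => [k|] /= ek.
- have {}ek : j = bump i k by have := congr1 val ek.
  rewrite -cube_extE ek /bump; case: (leqP i k) => ik; last by rewrite add0n ik.
  by rewrite add1n !ifN //; lia.
- have -> : j = i by have := congr1 val ek.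
  by rewrite ltnn eqxx.
Qed.

Lemma cube_ext_delete n (i : 'I_n.+1) (x : cube n.+1) j :
  cube_ext (cube_delete i x) j =
  if j < i then cube_ext x j else cube_ext x j.+1.
Proof.
have [jn|jn] := ltnP j n; last first.
  have ij := leq_trans (ltn_ord i : i <= n) jn.
  by rewrite cube_ext_out // ifN ?cube_ext_out //; lia.
rewrite (cube_ext_lt _ jn) ffunE -cube_extE /= /bump.
by case: leqP.
Qed.

(* f inserts k constant coordinates in front. *)
Definition front_insert (k m n : nat) (f : box_hom m n) : Prop :=
  exists a : nat -> bool, forall (x : cube m) j,
    cube_ext (sval f x) j = if j < k then a j else cube_ext x (j - k).

Fixpoint front (k m : nat) : cube k -> box_hom m (k + m) :=
  match k return cube k -> box_hom m (k + m) with
  | 0 => fun _ => box_id m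
  | k'.+1 => fun eps =>
      box_comp (front m [ffun j => eps (lift ord_max j)])
        (delta (n := k' + m) ord0 (eps ord_max))
  end.

Lemma iter_face1E (X : cubical_set) k m (eps : cube k) (x : X (k + m)%N) :
  iter_face1 eps x = @psh_map box X m (k + m)%N (front m eps) x.
Proof.
elim: k eps x => [|k IH] eps x /=; first by rewrite (@psh_id box X).
by rewrite IH (@psh_cmp box X).
Qed.

Lemma frontE k m (eps : cube k) (x : cube m) j :
  cube_ext (sval (front m eps) x) j =
  if j < k then cube_ext eps (k.-1 - j) else cube_ext x (j - k).
Proof.
elim: k eps j => [|k IH] eps j /=; first by rewrite subn0.
rewrite cube_ext_insert ltn0; case: j => [|j] /=.
  by rewrite subn0 (cube_extE eps ord_max).
rewrite IH ltnS subSS; case: ltnP => // jk.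
have lk : k.-1 - j < k by lia.
rewrite (cube_ext_lt _ lk) ffunE -cube_extE lift_max /=.
by congr (cube_ext _ _); lia.
Qed.

Lemma front_insert_front k m (eps : cube k) : front_insert k (front m eps).
Proof. by exists (fun j => cube_ext eps (k.-1 - j)) => x j; rewrite frontE. Qed.

Lemma front_insertP k m (f : box_hom m (k + m)) :
  front_insert k f -> exists eps, f = front m eps.
Proof.
case=> a fa; exists [ffun j : 'I_k => a (k.-1 - j)].
apply: box_hom_eq => x; apply: cube_ext_inj => j; rewrite fa frontE.
case: ltnP => // jk; have lk : k.-1 - j < k by lia.
by rewrite (cube_ext_lt _ lk) ffunE /=; congr (a _); lia.
Qed.

Lemma front_insert_ex k m n (a : nat -> bool) : n = (k + m)%N ->
  exists f : box_hom m n, forall (x : cube m) j,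
    cube_ext (sval f x) j = if j < k then a j else cube_ext x (j - k).
Proof.
move=> ->; exists (front m [ffun j : 'I_k => a (k.-1 - j)]) => x j.
rewrite frontE; case: ltnP => // jk; have lk : k.-1 - j < k by lia.
by rewrite (cube_ext_lt _ lk) ffunE /=; congr (a _); lia.
Qed.

Lemma L_condP (X : cubical_set) n (x : X n) :
  L_cond x <->
  (forall k m, n = (k + m)%N -> forall f g : box_hom m n,
     front_insert k f -> front_insert k g ->
     @psh_map box X m n f x = @psh_map box X m n g x).
Proof.
split=> [Lx k m e f g|Hx k m e k0 eps eps'].
- subst n => fi gi; case: k x Lx f g fi gi => [|k] x Lx f g fi gi.
    have -> // : f = g.
    case: fi gi => [a fa] [b gb]; apply: box_hom_eq => y.
    by apply: cube_ext_inj => j; rewrite fa gb.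
  have [eps ->] := front_insertP fi; have [eps' ->] := front_insertP gi.
  by rewrite -!iter_face1E; apply: (Lx k.+1 m erefl).
- subst n; rewrite /= !iter_face1E.
  by apply: Hx => //; apply: front_insert_front.
Qed.

Lemma L_cond_map (X : cubical_set) m n (f : box_hom m n) (x : X n) :
  L_cond x -> L_cond (@psh_map box X m n f x).
Proof.
elim/box_hom_ind: m n / f x => [n|m n p f g IHf IHg|n i e|n i] x Lx.
- by rewrite (@psh_id box X).
- by rewrite (@psh_cmp box X); apply/IHf/IHg.
- apply/L_condP => k m nkm f g [a fa] [b gb]; rewrite -!(@psh_cmp box X) /=.
  have [ik|ki] := leqP i k.
    apply: (proj1 (L_condP x) Lx k.+1) => //; first by rewrite nkm.
    + exists (fun j => if j < i then a j else if j == i then e else a j.-1).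
      move=> y j; rewrite /= cube_ext_insert !fa.
      case: (ltnP j i) => ji; first by rewrite !ifT //; lia.
      case: eqP => ji'; first by rewrite ifT //; lia.
      case: ifP => h1; case: ifP => h2 //; try lia.
      by congr (cube_ext _ _); lia.
    + exists (fun j => if j < i then b j else if j == i then e else b j.-1).
      move=> y j; rewrite /= cube_ext_insert !gb.
      case: (ltnP j i) => ji; first by rewrite !ifT //; lia.
      case: eqP => ji'; first by rewrite ifT //; lia.
      case: ifP => h1; case: ifP => h2 //; try lia.
      by congr (cube_ext _ _); lia.
  have im : i - k < m.+1 by have := ltn_ord i; lia.
  have e' : n.+1 = (k + m.+1)%N by lia.
  have aux (c : nat -> bool) (h : box_hom m n) (h' : box_hom m.+1 n.+1) :
      (forall (y : cube m) j, cube_ext (sval h y) j =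
         if j < k then c j else cube_ext y (j - k)) ->
      (forall (y : cube m.+1) j, cube_ext (sval h' y) j =
         if j < k then c j else cube_ext y (j - k)) ->
      box_comp h (delta i e) = box_comp (delta (Ordinal im) e) h'.
    move=> hc hc'; apply: box_hom_eq => y; apply: cube_ext_inj => j /=.
    rewrite hc' !cube_ext_insert /= !hc.
    case: (ltnP j k) => jk; first by rewrite ifT //; lia.
    case: (ltnP j i) => ji; first by rewrite ifT //; lia.
    case: (eqVneq j i) => ji' /=; first by rewrite ifN ?ifT //; lia.
    by rewrite !ifN; try lia; congr (cube_ext _ _); lia.
  have [f' fa'] := front_insert_ex a e'; have [g' gb'] := front_insert_ex b e'.
  rewrite (aux _ _ _ fa fa') (aux _ _ _ gb gb') !(@psh_cmp box X) /=.
  congr (psh_map X _ _).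
  by apply: (proj1 (L_condP x) Lx k m.+1 e'); [exists a|exists b].
- apply/L_condP => k m nkm f g [a fa] [b gb]; rewrite -!(@psh_cmp box X) /=.
  have [ik|ki] := ltnP i k.
    apply: (proj1 (L_condP x) Lx k.-1); first by lia.
    + exists (fun j => if j < i then a j else a j.+1).
      move=> y j; rewrite /= cube_ext_delete !fa.
      case: (ltnP j i) => ji; first by rewrite !ifT //; lia.
      case: ifP => h1; case: ifP => h2 //; try lia.
      by congr (cube_ext _ _); lia.
    + exists (fun j => if j < i then b j else b j.+1).
      move=> y j; rewrite /= cube_ext_delete !gb.
      case: (ltnP j i) => ji; first by rewrite !ifT //; lia.
      case: ifP => h1; case: ifP => h2 //; try lia.
      by congr (cube_ext _ _); lia.
  case: m nkm f g fa gb => [|m] nkm f g fa gb.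
    by have := ltn_ord i; lia.
  have im : i - k < m.+1 by have := ltn_ord i; lia.
  have e' : n = (k + m)%N by lia.
  have aux (c : nat -> bool) (h : box_hom m.+1 n.+1) (h' : box_hom m n) :
      (forall (y : cube m.+1) j, cube_ext (sval h y) j =
         if j < k then c j else cube_ext y (j - k)) ->
      (forall (y : cube m) j, cube_ext (sval h' y) j =
         if j < k then c j else cube_ext y (j - k)) ->
      box_comp h (sigma i) = box_comp (sigma (Ordinal im)) h'.
    move=> hc hc'; apply: box_hom_eq => y; apply: cube_ext_inj => j /=.
    rewrite hc' !cube_ext_delete /= !hc.
    case: (ltnP j k) => jk; first by rewrite ifT //; lia.
    case: (ltnP j i) => ji; first by rewrite ifT //; lia.
    by rewrite !ifN; try lia; congr (cube_ext _ _); lia.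
  have [f' fa'] := front_insert_ex a e'; have [g' gb'] := front_insert_ex b e'.
  rewrite (aux _ _ _ fa fa') (aux _ _ _ gb gb') !(@psh_cmp box X) /=.
  congr (psh_map X _ _).
  by apply: (proj1 (L_condP x) Lx k m e'); [exists a|exists b].
Qed.

Definition L_map (X : cubical_set) (hX : reduced X) m n (f : box_hom m n)
    (y : L_ob X n) : L_ob X m :=
  L_mk (L_cond_map f (L_incl_cond hX y)).

Lemma L_incl_map (X : cubical_set) (hX : reduced X) m n (f : box_hom m n)
    (y : L_ob X n) :
  L_incl hX (L_map hX f y) = @psh_map box X m n f (L_incl hX y).
Proof. exact: L_inclK. Qed.

Lemma L_map_id (X : cubical_set) (hX : reduced X) n (y : L_ob X n) :
  L_map hX (box_id n) y = y.
Proof. by apply: (@L_incl_inj X hX); rewrite L_incl_map (@psh_id box X). Qed.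

Lemma L_map_comp (X : cubical_set) (hX : reduced X) m n p (f : box_hom m n)
    (g : box_hom n p) (y : L_ob X p) :
  L_map hX (box_comp f g) y = L_map hX f (L_map hX g y).
Proof.
by apply: (@L_incl_inj X hX); rewrite !L_incl_map (@psh_cmp box X).
Qed.

Definition L (X : cubical_set) (hX : reduced X) : cubical_set :=
  @Presheaf box (L_ob X) (@L_map X hX) (@L_map_id X hX) (@L_map_comp X hX).

Definition trivial_functor (C : category) (G : groupType) :
    functor C (group_cat G) :=
  @Functor C (group_cat G) (fun _ => tt) (fun _ _ _ => 1 : G)
    (fun _ => erefl) (fun _ _ _ _ _ => esym (mul1g 1)).

Lemma nerve0_unique (G : groupType) (F : nerve G 0) :
  F = trivial_functor (cube_cat 0) G.
Proof.
apply: functor_group_eq => x y.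
have -> : y = x by apply/ffunP => -[].
move=> f; have -> : f = idm x by apply: bool_irrelevance.
by rewrite fmap_id.
Qed.

Definition nerve_reduced (G : groupType) : reduced (nerve G) :=
  exist _ (trivial_functor (cube_cat 0) G) (@nerve0_unique G).

Definition NR_ob (G : groupType) (n : nat) : Type := {ffun 'I_n -> G}.

Definition NR_face (G : groupType) n (i : 'I_n.+1) (e : bool)
    (g : NR_ob G n.+1) : NR_ob G n :=
  if e then
    [ffun j : 'I_n => if j < i then (g i)^-1 * g (lift i j) * g i
                      else g (lift i j)]
  else [ffun j => g (lift i j)].

Definition NR_degeneracy (G : groupType) n (i : 'I_n.+1)
    (g : NR_ob G n) : NR_ob G n.+1 :=
  [ffun j => if unlift i j is Some k then g k else 1].

(* The coherence of these operators is obtained from the function on vertices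
   x |-> \prod_(j | x_j = 1) g_j, which determines g and is transported by the
   operators up to left multiplication by a constant. *)
Definition NR_potential (G : groupType) n (g : NR_ob G n) (x : cube n) : G :=
  \prod_(j < n) (if x j then g j else 1).

Lemma prodg_lift (G : groupType) n (i : 'I_n.+1) (F : 'I_n.+1 -> G) :
  \prod_(j < n.+1) F j =
  F i * \prod_(j < n) (if j < i then (F i)^-1 * F (lift i j) * F i
                       else F (lift i j)).
Proof.
elim: n i F => [|n IH] i F.
  by rewrite (ord1 i) big_ord_recl !big_ord0.
have [i'|->] := unliftP ord0 i; last by rewrite big_ord_recl.
move=> ->; rewrite big_ord_recl (IH i') [in RHS]big_ord_recl /=.
have -> : lift (lift ord0 i') ord0 = ord0 by apply: val_inj.
rewrite !mulgA mulgV mul1g; congr (_ * _); apply: eq_bigr => j _.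
rewrite /bump /= !add1n ltnS.
by have -> : lift (lift ord0 i') (lift ord0 j) = lift ord0 (lift i' j)
  by apply: val_inj; rewrite /= /bump; lia.
Qed.

Lemma NR_potential_word (G : groupType) m n (w : box_word m n)
    (g : NR_ob G n) :
  exists c : G, forall x, NR_potential g (word_fun w x) =
    c * NR_potential (word_act (@NR_face G) (@NR_degeneracy G) w g) x.
Proof.
elim: w g => {m n} [n|m n p u IHu v IHv|n i e|n i] g /=.
- by exists 1 => x; rewrite mul1g.
- have [c cP] := IHv g.
  have [c' cP'] := IHu (word_act (@NR_face G) (@NR_degeneracy G) v g).
  by exists (c * c') => x; rewrite cP cP' mulgA.
- exists (if e then g i else 1) => x.
  rewrite {1}/NR_potential (prodg_lift i) ffunE unlift_none; congr (_ * _).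
  apply: eq_bigr => j _; rewrite /NR_face ffunE liftK.
  by case: e; rewrite ffunE; case: ifP => // _;
     case: (x j); rewrite ?mulg1 ?invg1 ?mulVg ?mul1g.
- exists 1 => x; rewrite mul1g [RHS](prodg_lift i) ffunE unlift_none.
  rewrite if_same mul1g; apply: eq_bigr => j _.
  by rewrite !ffunE liftK invg1 mul1g mulg1 if_same.
Qed.

Lemma NR_potential0 (G : groupType) n (g : NR_ob G n) :
  NR_potential g [ffun=> false] = 1.
Proof. by apply: big1 => j _; rewrite ffunE. Qed.

Lemma NR_potential1 (G : groupType) n (g : NR_ob G n) (i : 'I_n) :
  NR_potential g [ffun j => j == i] = g i.
Proof.
case: n g i => [|n] g i; first by case: i.
rewrite /NR_potential (prodg_lift i) ffunE eqxx big1 ?mulg1 // => j _.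
by rewrite ffunE eq_sym (negbTE (neq_lift _ _)) mulg1 mulVg if_same.
Qed.

Lemma NR_potential_inj (G : groupType) n (g h : NR_ob G n) (c d : G) :
  (forall x, c * NR_potential g x = d * NR_potential h x) -> g = h.
Proof.
move=> H; have := H [ffun=> false]; rewrite !NR_potential0 !mulg1 => cd.
by apply/ffunP => i; have := H [ffun j => j == i]; rewrite !NR_potential1 cd => /mulgI.
Qed.

Lemma NR_coherent (G : groupType) :
  word_coherent (@NR_face G) (@NR_degeneracy G).
Proof.
move=> m n w w' ww'; apply: funext => g.
have [c cP] := NR_potential_word w g; have [d dP] := NR_potential_word w' g.
by apply: (@NR_potential_inj _ _ _ _ c d) => x; rewrite -cP -dP ww'.
Qed.

Definition NR (G : groupType) : cubical_set :=
  cubical_of_generators (@NR_coherent G).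

(* Main.v *)
Require Import Defs.
From mathcomp Require Import all_boot.
From mathcomp Require Import boolp zify.

Set Implicit Arguments.
Unset Strict Implicit.
Unset Printing Implicit Defensive.

Local Open Scope group_scope.

(** A functor F from the poset {0,1}^n to G is the same thing as its potential
    x |-> F(0 <= x), a function on vertices with value 1 at the origin
    ([nerve_eq], [nerve_of_potential]).  Sending (g_1, ..., g_n) to the functor
    with potential x |-> g_1^(x_1) ... g_n^(x_n) is a morphism from NR G to the
    nerve, because restriction along a morphism of the box category changes
    potentials only by a left factor ([NR_potential_word]).  In NR G the faces
    d_{1,0} and d_{1,1} coincide, so every element of NR G satisfies the
    condition defining L; morphisms preserve this condition, hence the map
    lands in L of the nerve ([NR_to_L]).

    The inverse reads off g_i = F(0 <= e_i).  It is a left inverse since the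
    product above takes the value g_i at e_i.  It is a right inverse because an
    element of L of the nerve is determined by its values on the arrows
    0 <= e_i ([L_nerve_eq]): along the path from 0 to x that switches on the
    coordinates of x one at a time from left to right, the i-th step is
    F((a,0,0) <= (a,x_i,0)) for the first i - 1 coordinates a of x, and the
    condition defining L makes it independent of a. *)

Lemma psh_hom_eq (C : category) (X Y : presheaf C) (u v : psh_hom X Y) :
  (forall (x : C) (a : X x), u x a = v x a) -> u = v.
Proof.
case: u v => [u nu] [v nv] /= uv.
have {}uv : u = v.
  by apply: functional_extensionality_dep => x; apply: funext => a; apply: uv.
by subst v; rewrite (Prop_irrelevance nu nv).
Qed.

(** A natural transformation with a pointwise inverse is an isomorphism:
    naturality of the inverse is automatic. *)
Lemma isomorphic_bij (C : category) (X Y : presheaf C) (v : psh_hom Y X)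
    (u : forall x : C, X x -> Y x) :
  (forall x, cancel (v x) (u x)) -> (forall x, cancel (u x) (v x)) ->
  isomorphic X Y.
Proof.
move=> vK uK.
have nat_u (x y : C) (f : hom x y) (a : X y) :
    u x (psh_map X f a) = psh_map Y f (u y a).
  by rewrite -{1}(uK y a) -nt_natural vK.
by exists (PshHom nat_u), v; split; apply: psh_hom_eq => x a;
  [exact: uK|exact: vK].
Qed.

(** * The condition defining L *)

(** Morphisms of cubical sets preserve the condition defining L. *)
Lemma L_cond_nt (X Y : cubical_set) (u : psh_hom X Y) n (x : X n) :
  L_cond x -> L_cond (u n x).
Proof.
move/L_condP => Lx; apply/L_condP => k m nkm f g fi gi.
by rewrite -!(@nt_natural box) (Lx k m nkm f g).
Qed.

(** If d_{1,0} = d_{1,1} in all degrees, then every element satisfies the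
    condition defining L. *)
Lemma L_cond_face0 (X : cubical_set) :
  (forall n (x : X n.+1), face ord0 true x = face ord0 false x) ->
  forall n (x : X n), L_cond x.
Proof.
move=> X01 n x k m nkm _ eps eps'.
move: (ecast p (X p) nkm x) => {n x nkm} x.
elim: k x eps eps' => [//|k IH] x eps eps' /=.
rewrite (IH _ _ [ffun j => eps' (lift ord_max j)]); congr (iter_face1 _ _).
by case: (eps _); case: (eps' _); rewrite ?X01.
Qed.

(** The values of a morphism whose source satisfies the condition defining L,
    seen in L X; in degree 0 this is the constant map to the point. *)
Definition L_lift_fun (X Y : cubical_set) (u : psh_hom Y X)
    (LY : forall n (y : Y n), L_cond y) n (y : Y n) : L_ob X n :=
  L_mk (L_cond_nt u (LY n y)).

Lemma L_lift_natural (X Y : cubical_set) (hX : reduced X) (u : psh_hom Y X)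
    (LY : forall n (y : Y n), L_cond y) m n (f : box_hom m n) (y : Y n) :
  L_lift_fun u LY (@psh_map box Y m n f y) = L_map hX f (L_lift_fun u LY y).
Proof.
apply: (@L_incl_inj X hX).
by rewrite L_incl_map !L_inclK (@nt_natural box).
Qed.

(** A morphism into X factors through L X as soon as all elements of its source
    satisfy the condition defining L. *)
Definition L_lift (X Y : cubical_set) (hX : reduced X) (u : psh_hom Y X)
    (LY : forall n (y : Y n), L_cond y) : psh_hom Y (L hX) :=
  @PshHom box Y (L hX) (L_lift_fun u LY) (L_lift_natural hX u LY).

(** * Functors from a cube to a group as potentials *)

(** The origin, all of whose coordinates are 0. *)
Definition cube0 n : cube n := [ffun=> false].

(** The vertex e_i, whose only nonzero coordinate is the i-th one. *)
Definition cube_unit n (i : 'I_n) : cube n := [ffun j => j == i].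

Lemma cube0_le n (x : cube n) : cube_le (cube0 n) x.
Proof. by apply/forallP => i; rewrite ffunE. Qed.

(** The value of a functor on the arrow from the origin to a vertex. *)
Definition potential (G : groupType) n (F : nerve G n) (x : cube n) : G :=
  fmap F (cube0_le x : @hom (cube_cat n) _ _).

Lemma potential0 (G : groupType) n (F : nerve G n) :
  potential F (cube0 n) = 1.
Proof.
rewrite /potential.
have -> : cube0_le (cube0 n) = idm (cube0 n : cube_cat n)
  by apply: bool_irrelevance.
by rewrite fmap_id.
Qed.

Lemma fmap_potential (G : groupType) n (F : nerve G n) (x y : cube_cat n)
    (xy : hom x y) :
  fmap F xy = (potential F x)^-1 * potential F y :> G.
Proof.
rewrite /potential.
have -> : cube0_le y = cmp (cube0_le x : @hom (cube_cat n) _ _) xy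
  by apply: bool_irrelevance.
by rewrite fmap_cmp /= mulKg.
Qed.

Lemma nerve_eq (G : groupType) n (F H : nerve G n) :
  potential F =1 potential H -> F = H.
Proof.
by move=> FH; apply: functor_group_eq => x y f; rewrite !fmap_potential !FH.
Qed.

Lemma potential_map (G : groupType) m n (f : box_hom m n) (F : nerve G n)
    (x : cube m) :
  potential (nerve_map f F) x =
  (potential F (sval f (cube0 m)))^-1 * potential F (sval f x).
Proof. by rewrite {1}/potential /= fmap_potential. Qed.

Lemma mulg_quotient_trans (G : groupType) n (P : cube n -> G)
    (x y z : cube n) : (P x)^-1 * P z = (P x)^-1 * P y * ((P y)^-1 * P z).
Proof. by rewrite mulgA mulgK. Qed.

(** The functor sending x <= y to P(x)^-1 P(y). *)
Definition nerve_of_potential (G : groupType) n (P : cube n -> G) :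
    nerve G n :=
  @Functor (cube_cat n) (group_cat G) (fun _ => tt)
    (fun x y _ => (P x)^-1 * P y)
    (fun x => mulVg (P x))
    (fun x y z _ _ => mulg_quotient_trans P x y z).

Lemma potential_of (G : groupType) n (P : cube n -> G) (x : cube n) :
  potential (nerve_of_potential P) x = (P (cube0 n))^-1 * P x.
Proof. by []. Qed.

(** * Elements of L of the nerve are determined by their values at 0 <= e_i *)

(** The vertex obtained from x by keeping its first k coordinates and setting
    the others to 0. *)
Definition cube_trunc n (k : nat) (x : cube n) : cube n :=
  [ffun j : 'I_n => (j < k) && x j].

Lemma cube_ext_trunc n k (x : cube n) j :
  cube_ext (cube_trunc k x) j = (j < k) && cube_ext x j.
Proof.
have [jn|nj] := ltnP j n; last by rewrite !cube_ext_out // andbF.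
by rewrite !(cube_ext_lt _ jn) ffunE.
Qed.

Lemma cube_ext0 n j : cube_ext (cube0 n) j = false.
Proof.
have [jn|nj] := ltnP j n; last by rewrite cube_ext_out.
by rewrite (cube_ext_lt _ jn) ffunE.
Qed.

Lemma cube_ext_unit n (i : 'I_n) j : cube_ext (cube_unit i) j = (j == i).
Proof.
have [jn|nj] := ltnP j n; first by rewrite (cube_ext_lt _ jn) ffunE.
by rewrite cube_ext_out //; have := ltn_ord i; lia.
Qed.

(** One step of the path from the origin to x: the value of F on the arrow that
    switches on coordinate i does not depend on the coordinates before i. *)
Lemma L_nerve_step (G : groupType) n (F : nerve G n) (x : cube n) (i : 'I_n) :
  L_cond F ->
  potential F (cube_trunc i.+1 x) =
  potential F (cube_trunc i x) * (if x i then potential F (cube_unit i) else 1).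
Proof.
move=> LF; case: ifP => xi; last first.
  rewrite mulg1; congr potential; apply/ffunP => j; rewrite !ffunE ltnS.
  by rewrite leq_eqVlt; case: eqP => // /val_inj ->; rewrite xi !andbF.
(* The maps f and g insert i constant coordinates in front, those of x and
   zeros respectively; L identifies the restrictions of F along them, which are
   compared on the arrow from the origin to the first unit vertex. *)
have ni : n = (i + (n - i.+1).+1)%N by have := ltn_ord i; lia.
have [f fE] := front_insert_ex (cube_ext x) ni.
have [g gE] := front_insert_ex (fun=> false) ni.
have fg : nerve_map f F = nerve_map g F.
  apply: (proj1 (L_condP F) LF _ _ ni).
    by exists (cube_ext x).
  by exists (fun=> false).
have := congr1 (fun H => potential H (cube_unit ord0)) fg.
rewrite !potential_map.
have -> : sval f (cube0 _) = cube_trunc i x.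
  apply: cube_ext_inj => j; rewrite fE cube_ext_trunc cube_ext0.
  by case: ifP.
have -> : sval g (cube0 _) = cube0 n.
  by apply: cube_ext_inj => j; rewrite gE !cube_ext0 if_same.
have -> : sval f (cube_unit ord0) = cube_trunc i.+1 x.
  apply: cube_ext_inj => j; rewrite fE cube_ext_trunc cube_ext_unit /= ltnS.
  case: (ltngtP j i) => [|ij|->] //=; last by rewrite subnn cube_extE xi.
  by apply/eqP; lia.
have -> : sval g (cube_unit ord0) = cube_unit i.
  apply: cube_ext_inj => j; rewrite gE !cube_ext_unit /=.
  by case: ltnP => ij; lia.
by rewrite potential0 invg1 mul1g => <-; rewrite mulVKg.
Qed.

Lemma L_nerve_eq (G : groupType) n (F H : nerve G n) :
  L_cond F -> L_cond H ->
  (forall i, potential F (cube_unit i) = potential H (cube_unit i)) -> F = H.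
Proof.
move=> LF LH FH; apply: nerve_eq => x.
have <- : cube_trunc n x = x by apply/ffunP => j; rewrite ffunE ltn_ord.
suff trunc_eq k : k <= n ->
    potential F (cube_trunc k x) = potential H (cube_trunc k x).
  exact: trunc_eq.
elim: k => [_|k IH kn].
  have -> : cube_trunc 0 x = cube0 n by apply/ffunP => j; rewrite !ffunE.
  by rewrite !potential0.
rewrite (L_nerve_step x (Ordinal kn) LF) (L_nerve_step x (Ordinal kn) LH) /=.
by rewrite FH IH // ltnW.
Qed.

(** * The isomorphism *)

Lemma NR_to_nerve_natural (G : groupType) m n (f : box_hom m n) (g : NR G n) :
  nerve_of_potential (NR_potential (@psh_map box (NR G) m n f g)) =
  nerve_map f (nerve_of_potential (NR_potential g)).
Proof.
apply: nerve_eq => x; rewrite potential_map !potential_of /= /box_act.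
case: cid => w /= fw.
have [c cP] := NR_potential_word w g.
by rewrite fw !cP !invgM !invgK !mulgA mulgK mulgVK.
Qed.

(** A tuple g is sent to the functor with potential
    x |-> g_1^(x_1) ... g_n^(x_n). *)
Definition NR_to_nerve (G : groupType) : psh_hom (NR G) (nerve G) :=
  @PshHom box (NR G) (nerve G) (fun n g => nerve_of_potential (NR_potential g))
    (@NR_to_nerve_natural G).

Lemma potential_NR_to_nerve (G : groupType) n (g : NR G n) (x : cube n) :
  potential (NR_to_nerve G n g) x = NR_potential g x.
Proof. by rewrite potential_of NR_potential0 invg1 mul1g. Qed.

(** No coordinate precedes the first one, so d_{1,1} conjugates nothing. *)
Lemma L_cond_NR (G : groupType) n (g : NR G n) : L_cond g.
Proof.
move: n g; apply: L_cond_face0 => n g.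
rewrite /NR !cubical_of_generators_face.
by apply/ffunP => j; rewrite !ffunE.
Qed.

(** The corestriction of [NR_to_nerve] to L of the nerve. *)
Definition NR_to_L (G : groupType) : psh_hom (NR G) (L (nerve_reduced G)) :=
  L_lift (nerve_reduced G) (NR_to_nerve G) (@L_cond_NR G).

Lemma L_incl_NR_to_L (G : groupType) n (g : NR G n) :
  L_incl (nerve_reduced G) (NR_to_L G n g) = NR_to_nerve G n g.
Proof. exact: L_inclK. Qed.

(** The tuple of the values F(0 <= e_i). *)
Definition L_to_NR (G : groupType) n (F : L (nerve_reduced G) n) : NR G n :=
  [ffun i : 'I_n => potential (L_incl (nerve_reduced G) F) (cube_unit i)].

Theorem proposition3p2 (G : groupType) :
  isomorphic (L (nerve_reduced G)) (NR G).
Proof.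
apply: (@isomorphic_bij _ _ _ (NR_to_L G) (@L_to_NR G)) => n.
- move=> g; apply/ffunP => i.
  by rewrite ffunE L_incl_NR_to_L potential_NR_to_nerve NR_potential1.
- move=> F; apply: (@L_incl_inj _ (nerve_reduced G)).
  apply: L_nerve_eq => [||i]; try exact: L_incl_cond.
  by rewrite L_incl_NR_to_L potential_NR_to_nerve NR_potential1 ffunE.
Qed.
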